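(* Let $m\ge1$, $0<q<1$. With $E_z=\sum_iz_i\partial_{z_i}$ and $E_w=\sum_iw_i\partial_{w_i}$, the following hold on $\mathscr P_m$: $$\widehat{\mathcal Z}^2=(\widehat{\mathcal Z}^\dagger)^2=0,\qquad\{\widehat{\mathcal Z},\widehat{\mathcal Z}^\dagger\}=\widehat\rho,$$ $$\{\mathcal D_q,\widehat{\mathcal Z}^\dagger\}=0,\qquad\{\mathcal D_q^\dagger,\widehat{\mathcal Z}\}=0,$$ $$\{\mathcal D_q,\widehat{\mathcal Z}\}=E_z+\mathsf N,\qquad\{\mathcal D_q^\dagger,\widehat{\mathcal Z}^\dagger\}=E_w+m-\mathsf N.$$ Moreover $\Delta_q=G_q\Delta G_q^{-1}$, where $\Delta=\sum_i\partial_{z_i}\partial_{w_i}$ and $\Delta_q=\sum_iD_{q,z_i}D_{q,w_i}$.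
   Context: $\{X,Y\}=XY+YX$; $[r]_q=\frac{1-q^r}{1-q}$, $[\alpha]_q!=\prod_i\prod_{k=1}^{\alpha_i}[k]_q$, $\alpha!=\prod_i\alpha_i!$. $\mathscr P_m=\mathbb C[z_1,\dots,z_m,w_1,\dots,w_m]\otimes\bigwedge\mathbb C^m$ with basis $z^\alpha w^\beta e_S$. $D_{q,x}f=\frac{f(\dots,qx,\dots)-f(\dots,x,\dots)}{(q-1)x}$; $\varepsilon_i$ is exterior multiplication by the $i$-th basis vector, $\iota_i=\varepsilon_i^*$ contraction; $\mathsf N=\sum_i\varepsilon_i\iota_i$. $\mathcal D_q=\sum_i\varepsilon_iD_{q,z_i}$, $\mathcal D_q^\dagger=\sum_i\iota_iD_{q,w_i}$. $G_q$ is the diagonal automorphism $G_q(z^\alpha w^\beta e_S)=\frac{\alpha!\,\beta!}{[\alpha]_q!\,[\beta]_q!}z^\alpha w^\beta e_S$. $\widehat z_i=G_qz_iG_q^{-1}$, $\widehat w_i=G_qw_iG_q^{-1}$ (with $z_i,w_i$ multiplication operators), $\widehat{\mathcal Z}=\sum_i\iota_i\widehat z_i$, $\widehat{\mathcal Z}^\dagger=\sum_i\varepsilon_i\widehat w_i$, $\widehat\rho=\sum_i\widehat z_i\widehat w_i$. *)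

(* Defs.v *)
From HB Require Import structures.
From mathcomp Require Import all_boot all_order all_algebra.
From mathcomp Require Import mpoly complex reals.

Set Implicit Arguments.
Unset Strict Implicit.
Unset Printing Implicit Defensive.

Import Order.TTheory GRing.Theory Num.Theory.
Local Open Scope ring_scope.
Local Open Scope complex_scope.

(* An element of C[z_1..z_m, w_1..w_m] (x) /\ C^m is the family of its
   coordinates on (e_S)_S. In {mpoly R[i][m + m]} the variable z_i has index
   lshift m i and w_i has index rshift m i. *)
Notation Pm R m := ({ffun {set 'I_m} -> {mpoly R[i][m + m]}}).

Definition zidx (m : nat) (i : 'I_m) : 'I_(m + m) := lshift m i.
Definition widx (m : nat) (i : 'I_m) : 'I_(m + m) := rshift m i.

Definition zexp (m : nat) (a : 'X_{1..m + m}) : 'X_{1..m} :=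
  [multinom a (zidx i) | i < m].
Definition wexp (m : nat) (a : 'X_{1..m + m}) : 'X_{1..m} :=
  [multinom a (widx i) | i < m].

(* z^a w^b e_S *)
Definition basis_elt (R : realType) (m : nat) (a b : 'X_{1..m})
    (S : {set 'I_m}) : Pm R m :=
  [ffun T => if T == S then
     (\prod_i 'X_(zidx i) ^+ a i) * (\prod_i 'X_(widx i) ^+ b i) else 0].

Definition qint (F : fieldType) (q : F) (r : nat) : F := (1 - q ^+ r) / (1 - q).

Definition mfact (m : nat) (a : 'X_{1..m}) : nat := \prod_i (a i)`!.

Definition qmfact (F : fieldType) (q : F) (m : nat) (a : 'X_{1..m}) : F :=
  \prod_i \prod_(1 <= k < (a i).+1) qint q k.

Definition coefwise (R : realType) (m : nat)
    (f : {mpoly R[i][m + m]} -> {mpoly R[i][m + m]}) (u : Pm R m) : Pm R m :=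
  [ffun S => f (u S)].

(* f(.., c x_i, ..) *)
Definition dilate (F : fieldType) (n : nat) (i : 'I_n) (c : F)
    (p : {mpoly F[n]}) : {mpoly F[n]} :=
  p \mPo [tuple if j == i then c *: 'X_j else 'X_j | j < n].

(* Quotient of p by 'X_i; terms not divisible by 'X_i are dropped, so this is
   the exact quotient when 'X_i divides p (see qderivP). *)
Definition divX (F : fieldType) (n : nat) (i : 'I_n) (p : {mpoly F[n]}) :
    {mpoly F[n]} :=
  \sum_(a <- msupp p | (0 < a i)%N) p@_a *: 'X_[a - U_(i)].

Definition qderiv (F : fieldType) (n : nat) (q : F) (i : 'I_n)
    (p : {mpoly F[n]}) : {mpoly F[n]} :=
  (q - 1)^-1 *: divX i (dilate i q p - p).

Definition mulz (R : realType) (m : nat) (i : 'I_m) : Pm R m -> Pm R m :=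
  coefwise (fun p => 'X_(zidx i) * p).
Definition mulw (R : realType) (m : nat) (i : 'I_m) : Pm R m -> Pm R m :=
  coefwise (fun p => 'X_(widx i) * p).
Definition dz (R : realType) (m : nat) (i : 'I_m) : Pm R m -> Pm R m :=
  coefwise (mderiv (zidx i)).
Definition dw (R : realType) (m : nat) (i : 'I_m) : Pm R m -> Pm R m :=
  coefwise (mderiv (widx i)).
Definition Dqz (R : realType) (m : nat) (q : R) (i : 'I_m) :
    Pm R m -> Pm R m :=
  coefwise (qderiv q%:C (zidx i)).
Definition Dqw (R : realType) (m : nat) (q : R) (i : 'I_m) :
    Pm R m -> Pm R m :=
  coefwise (qderiv q%:C (widx i)).

(* Coordinate on e_T of e_i /\ e_S, where e_S is the wedge of the e_j, j in S,
   in increasing order. *)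
Definition wedge_coef (R : realType) (m : nat) (i : 'I_m) (S T : {set 'I_m}) :
    R[i] :=
  if (i \notin S) && (T == i |: S)
  then (-1) ^+ #|[set j in S | (j < i)%N]| else 0.

Definition epsi (R : realType) (m : nat) (i : 'I_m) (u : Pm R m) : Pm R m :=
  [ffun T => \sum_S wedge_coef R i S T *: u S].

(* Adjoint of epsi i for the Hermitian product making (e_S)_S orthonormal: its
   matrix is the conjugate transpose of that of epsi i. *)
Definition iotai (R : realType) (m : nat) (i : 'I_m) (u : Pm R m) : Pm R m :=
  [ffun S => \sum_T (wedge_coef R i S T)^* *: u T].

Definition anticomm (V : zmodType) (A B : V -> V) (u : V) : V :=
  A (B u) + B (A u).

Definition opN (R : realType) (m : nat) (u : Pm R m) : Pm R m :=
  \sum_i epsi i (iotai i u).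

Definition Dq (R : realType) (m : nat) (q : R) (u : Pm R m) : Pm R m :=
  \sum_i epsi i (Dqz q i u).
Definition Dq_dag (R : realType) (m : nat) (q : R) (u : Pm R m) : Pm R m :=
  \sum_i iotai i (Dqw q i u).

Definition diag_mpoly (F : fieldType) (n : nat) (c : 'X_{1..n} -> F)
    (p : {mpoly F[n]}) : {mpoly F[n]} :=
  \sum_(a <- msupp p) (c a * p@_a) *: 'X_[a].

Definition Gq_eigen (R : realType) (m : nat) (q : R) (a b : 'X_{1..m}) : R[i] :=
  ((mfact a)%:R * (mfact b)%:R) / (qmfact q%:C a * qmfact q%:C b).

Definition Gq (R : realType) (m : nat) (q : R) : Pm R m -> Pm R m :=
  coefwise (diag_mpoly (fun a => Gq_eigen q (zexp a) (wexp a))).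
Definition Gq_inv (R : realType) (m : nat) (q : R) : Pm R m -> Pm R m :=
  coefwise (diag_mpoly (fun a => (Gq_eigen q (zexp a) (wexp a))^-1)).

Definition Gconj (R : realType) (m : nat) (q : R) (A : Pm R m -> Pm R m)
    (u : Pm R m) : Pm R m :=
  Gq q (A (Gq_inv q u)).

Definition zhat (R : realType) (m : nat) (q : R) (i : 'I_m) :
  Pm R m -> Pm R m := Gconj q (mulz i).
Definition what (R : realType) (m : nat) (q : R) (i : 'I_m) :
  Pm R m -> Pm R m := Gconj q (mulw i).

Definition Zhat (R : realType) (m : nat) (q : R) (u : Pm R m) : Pm R m :=
  \sum_i iotai i (zhat q i u).
Definition Zhat_dag (R : realType) (m : nat) (q : R) (u : Pm R m) : Pm R m :=
  \sum_i epsi i (what q i u).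
Definition rhohat (R : realType) (m : nat) (q : R) (u : Pm R m) : Pm R m :=
  \sum_i zhat q i (what q i u).

Definition Ez (R : realType) (m : nat) (u : Pm R m) : Pm R m :=
  \sum_i mulz i (dz i u).
Definition Ew (R : realType) (m : nat) (u : Pm R m) : Pm R m :=
  \sum_i mulw i (dw i u).

Definition Lap (R : realType) (m : nat) (u : Pm R m) : Pm R m :=
  \sum_i dz i (dw i u).
Definition Lapq (R : realType) (m : nat) (q : R) (u : Pm R m) : Pm R m :=
  \sum_i Dqz q i (Dqw q i u).

Lemma mcoeff_diag (F : fieldType) (n : nat) (c : 'X_{1..n} -> F)
    (p : {mpoly F[n]}) (a : 'X_{1..n}) : (diag_mpoly c p)@_a = c a * p@_a.
Proof.
rewrite /diag_mpoly raddf_sum /=.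
rewrite (eq_bigr (fun b => (b == a)%:R * (c a * p@_a))); last first.
  move=> b _; rewrite mcoeffZ mcoeffX mulrC.
  by case: eqP => [->|]; rewrite ?mul0r.
rewrite -mulr_suml; case: (boolP (a \in msupp p)) => ha.
  rewrite (bigD1_seq a) ?msupp_uniq //= eqxx big1 ?addr0 ?mul1r //.
  by move=> b /negbTE ->.
by rewrite (memN_msupp_eq0 ha) !mulr0.
Qed.

Lemma mcoeff_dilate (F : fieldType) (n : nat) (i : 'I_n) (c : F)
    (p : {mpoly F[n]}) (a : 'X_{1..n}) :
  (dilate i c p)@_a = c ^+ a i * p@_a.
Proof.
rewrite -(mcoeff_diag (fun b : 'X_{1..n} => c ^+ b i)); congr (_ @_ a).
rewrite /dilate comp_mpolyEX; apply: eq_bigr => b _.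
rewrite comp_mpolyX [in RHS]mulrC -scalerA; congr (_ *: _).
rewrite [X in _ *: X]mpolyXE_id /= (bigD1 i) //= [in RHS](bigD1 i) //=.
rewrite tnth_mktuple eqxx exprZn scalerAl; congr (_ * _).
by apply: eq_bigr => j /negbTE h; rewrite tnth_mktuple h.
Qed.

Lemma divXK (F : fieldType) (n : nat) (i : 'I_n) (p : {mpoly F[n]}) :
  (forall a : 'X_{1..n}, a i = 0%N -> p@_a = 0) -> 'X_i * divX i p = p.
Proof.
move=> h; rewrite [RHS]mpolyE /divX mulr_sumr big_mkcond /=.
apply: eq_bigr => a _; case: posnP => [/h ->|ha]; first by rewrite scale0r.
rewrite -scalerAr -mpolyXD addmC submK //.
by rewrite lep1mP -lt0n.
Qed.

Lemma qderivP (F : fieldType) (n : nat) (q : F) (i : 'I_n) (p : {mpoly F[n]}) :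
  q != 1 -> ((q - 1) *: 'X_i) * qderiv q i p = dilate i q p - p.
Proof.
move=> q1; rewrite /qderiv -scalerAr -scalerAl scalerA mulVf ?subr_eq0 //.
rewrite scale1r divXK // => a ha.
by rewrite mcoeffB mcoeff_dilate ha mul1r subrr.
Qed.

Lemma epsi_basis (R : realType) (m : nat) (i : 'I_m) (a b : 'X_{1..m})
    (S : {set 'I_m}) :
  epsi i (basis_elt R a b S) =
  if i \in S then 0
  else (-1 : R[i]) ^+ #|[set j in S | (j < i)%N]| *: basis_elt R a b (i |: S).
Proof.
apply/ffunP => T; rewrite ffunE (bigD1 S) //= big1 ?addr0; last first.
  by move=> U /negbTE h; rewrite ffunE h scaler0.
rewrite /wedge_coef ffunE eqxx; case: (i \in S) => /=.
  by rewrite scale0r ffunE.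
by rewrite !ffunE; case: eqP; rewrite ?scale0r ?scaler0.
Qed.

Lemma iotai_basis (R : realType) (m : nat) (i : 'I_m) (a b : 'X_{1..m})
    (S : {set 'I_m}) :
  iotai i (basis_elt R a b S) =
  if i \in S
  then (-1 : R[i]) ^+ #|[set j in S | (j < i)%N]| *: basis_elt R a b (S :\ i)
  else 0.
Proof.
apply/ffunP => T; rewrite ffunE (bigD1 S) //= big1 ?addr0; last first.
  by move=> U /negbTE h; rewrite ffunE h scaler0.
rewrite /wedge_coef ffunE eqxx; case: ifP; last first.
  move/andP => h; rewrite conjC0 scale0r; case: ifP => hi; rewrite !ffunE //.
  case: eqP => hT; rewrite ?scaler0 //; case: h.
  by rewrite hT setD11 setD1K.
case/andP => hT /eqP hS; rewrite hS setU11 ffunE ffunE setU1K // eqxx.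
rewrite rmorphXn rmorphN1; congr (_ ^+ _ *: _); apply: eq_card => j.
by rewrite !inE; case: eqP => [->|//]; rewrite ltnn !andbF.
Qed.

Lemma Gq_basis (R : realType) (m : nat) (q : R) (a b : 'X_{1..m})
    (S : {set 'I_m}) :
  Gq q (basis_elt R a b S) = Gq_eigen q a b *: basis_elt R a b S.
Proof.
pose c : 'X_{1..m + m} :=
  [multinom match split i with inl j => a j | inr j => b j end | i < m + m].
have cE : (\prod_i 'X_(zidx i) ^+ a i) * (\prod_i 'X_(widx i) ^+ b i)
    = 'X_[c] :> {mpoly R[i][m + m]}.
  rewrite mpolyXE_id big_split_ord /=; congr (_ * _); apply: eq_bigr => i _.
    by rewrite mnmE (unsplitK (inl i)).
  by rewrite mnmE (unsplitK (inr i)).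
have zc : zexp c = a by apply/mnmP => i; rewrite !mnmE (unsplitK (inl i)).
have wc : wexp c = b by apply/mnmP => i; rewrite !mnmE (unsplitK (inr i)).
apply/ffunP => T; rewrite !ffunE; apply/mpolyP => d; rewrite mcoeff_diag mcoeffZ.
case: (T == S); last by rewrite mcoeff0 !mulr0.
by rewrite cE mcoeffX; case: eqP => [<-|_]; rewrite ?zc ?wc ?mulr0.
Qed.

Lemma Gq_eigen_neq0 (R : realType) (m : nat) (q : R) (a b : 'X_{1..m}) :
  0 < q < 1 -> Gq_eigen q a b != 0.
Proof.
case/andP => q0 q1.
have qn0 (d : 'X_{1..m}) : qmfact q%:C d != 0.
  apply/prodf_neq0 => i _; rewrite prodf_seq_neq0; apply/allP => k.
  rewrite mem_index_iota => /andP[k0 _] /=.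
  rewrite /qint mulf_neq0 ?invr_eq0 // subr_eq0 eq_sym.
    rewrite -rmorphXn -(rmorph1 (real_complex R)) (inj_eq (@fmorph_inj _ _ _)).
    by rewrite lt_eqF // exprn_ilt1 // ?ltW // -lt0n.
  by rewrite -(rmorph1 (real_complex R)) (inj_eq (@fmorph_inj _ _ _)) lt_eqF.
have fn0 (d : 'X_{1..m}) : (mfact d)%:R != 0 :> R[i].
  by rewrite pnatr_eq0 -lt0n prodn_gt0 // => i; apply: fact_gt0.
by rewrite /Gq_eigen mulf_neq0 ?invr_eq0 ?mulf_neq0.
Qed.

Lemma GqK (R : realType) (m : nat) (q : R) :
  0 < q < 1 -> cancel (@Gq R m q) (@Gq_inv R m q).
Proof.
move=> hq u; apply/ffunP => S; rewrite !ffunE; apply/mpolyP => d.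
by rewrite !mcoeff_diag mulKf // Gq_eigen_neq0.
Qed.

Lemma Gq_invK (R : realType) (m : nat) (q : R) :
  0 < q < 1 -> cancel (@Gq_inv R m q) (@Gq R m q).
Proof.
move=> hq u; apply/ffunP => S; rewrite !ffunE; apply/mpolyP => d.
by rewrite !mcoeff_diag mulVKf // Gq_eigen_neq0.
Qed.

(* Main.v *)
From HB Require Import structures.
Require Import Defs.
From mathcomp Require Import all_boot all_order all_algebra.
From mathcomp Require Import mpoly complex reals.

Set Implicit Arguments.
Unset Strict Implicit.
Unset Printing Implicit Defensive.

(* G_q conjugates the classical operators z_k, d/dz_k to zhat_k and the
   q-derivative, so these satisfy the Weyl relations, while the eps_i and iota_j
   satisfy the canonical anticommutation relations. Since the former act on
   coefficients and the latter on exterior indices, they commute, and every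
   identity reduces to the anticommutator of sums of the form
   sum_i eps_i A_i and sum_j iota_j B_j with [A_i, B_j] = k delta_ij. *)

Import Order.TTheory GRing.Theory Num.Theory.
Local Open Scope ring_scope.

(** * Diagonal operators on polynomials, and the $q$-derivative as a conjugated derivative *)

Section DiagonalConjugation.
Variables (F : fieldType) (n : nat).
Implicit Types (c d : 'X_{1..n} -> F) (p : {mpoly F[n]}) (i : 'I_n).

Lemma diag_mpoly_is_linear c : linear (diag_mpoly c).
Proof.
move=> k p p'; apply/mpolyP => a.
by rewrite !(mcoeff_diag, mcoeffD, mcoeffZ) mulrDr mulrCA.
Qed.

HB.instance Definition _ c :=
  GRing.isLinear.Build F {mpoly F[n]} {mpoly F[n]} *:%R (diag_mpoly c)
    (diag_mpoly_is_linear c).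

Lemma diag_mpolyK c :
  (forall a, c a != 0) ->
  cancel (diag_mpoly (fun a => (c a)^-1)) (diag_mpoly c).
Proof. by move=> c0 p; apply/mpolyP => a; rewrite !mcoeff_diag mulVKf. Qed.

Lemma diag_mpolyVK c :
  (forall a, c a != 0) ->
  cancel (diag_mpoly c) (diag_mpoly (fun a => (c a)^-1)).
Proof. by move=> c0 p; apply/mpolyP => a; rewrite !mcoeff_diag mulKf. Qed.

Lemma diag_mpolyC c d p :
  diag_mpoly c (diag_mpoly d p) = diag_mpoly d (diag_mpoly c p).
Proof. by apply/mpolyP => a; rewrite !mcoeff_diag mulrCA. Qed.

(** The Euler operator is diagonal on monomials, hence commutes with every [diag_mpoly c];
    conjugation will leave it unchanged. *)
Lemma mulX_mderiv i p :
  'X_i * mderiv i p = diag_mpoly (fun a => (a i)%:R) p.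
Proof.
rewrite {1}[p]mpolyE raddf_sum mulr_sumr; apply: eq_bigr => a _.
rewrite /= mderivZ mderivX -!scalerAr scalerA mulrC.
(* Exponent subtraction is truncated, so $x_i x^{a-U_i}=x^a$ needs $a_i>0$; for $a_i=0$ the scalar
   vanishes. *)
case: (posnP (a i)) => [->|ai]; first by rewrite mul0r !scale0r.
by rewrite -mpolyXD addmC submK // lep1mP -lt0n.
Qed.

Lemma mderiv_mulX i j p :
  mderiv i ('X_j * p) = (i == j)%:R *: p + 'X_j * mderiv i p.
Proof.
rewrite mderivM mderivX mnm1E eq_sym; case: eqP => [->|_].
  by rewrite -{1}[U_(j)%MM]add0m addmK mpolyX0 scale1r mul1r scale1r.
by rewrite !scale0r mul0r.
Qed.

Lemma mcoeff_qderiv (q : F) i p (a : 'X_{1..n}) :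
  q != 1 -> (qderiv q i p)@_a = qint q (a i).+1 * p@_(a + U_(i)).
Proof.
move=> q1; have := congr1 (mcoeff (U_(i) + a)) (qderivP i p q1).
rewrite -scalerAl mcoeffZ mulrC mcoeffB mcoeff_dilate.
rewrite [_ * qderiv _ _ _]mulrC mcoeffMX addmC mnmDE mnm1E eqxx addn1.
rewrite -{2}[p@__]mul1r -mulrBl => h.
have q10 : q - 1 != 0 by rewrite subr_eq0.
(* Flip both signs in [qint] to match the divisor $q-1$ of the $q$-derivative. *)
by rewrite /qint -[1 - q ^+ _]opprB -[1 - q]opprB invrN mulrNN mulrAC -h mulfK.
Qed.

(** Both sides lower the $i$-th exponent by one, so only scalars are compared; the recurrence on [c]
    makes them agree. *)
Lemma qderiv_conj (q : F) c i :
  q != 1 -> (forall a, c a != 0) ->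
  (forall a, c (a + U_(i))%MM * qint q (a i).+1 = c a * (a i).+1%:R) ->
  qderiv q i =1
  diag_mpoly c \o mderiv i \o diag_mpoly (fun a => (c a)^-1).
Proof.
move=> q1 c0 cS p; apply/mpolyP => a; rewrite mcoeff_qderiv //= mcoeff_diag.
rewrite mcoeff_mderiv mcoeff_diag -[_ *+ _]mulr_natl [RHS]mulrA -cS.
by rewrite -mulrA mulrCA mulVKf.
Qed.
End DiagonalConjugation.

(** * Canonical anticommutation relations in the exterior algebra *)

Section Exterior.
Variables (R : realType) (m : nat).
Implicit Types (u v : Pm R m) (i j : 'I_m) (S T : {set 'I_m}).

Definition wedge_sign i S : R[i] := (-1) ^+ #|[set j in S | (j < i)%N]|.

(** Removing $i$ changes the number of elements below $j$ exactly when $i<j$. For $j=i$ the sign is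
    unchanged. *)
Lemma wedge_signD1 i j S : i \in S ->
  wedge_sign j (S :\ i) = (-1) ^+ (i < j)%N * wedge_sign j S.
Proof.
move=> iS; rewrite /wedge_sign.
case: ltnP => ij; last first.
  rewrite mul1r; congr (_ ^+ _); apply: eq_card => l; rewrite !inE.
  by case: eqP => //= ->; rewrite ltnNge ij andbF.
rewrite [in RHS](cardsD1 i) !inE iS ij add1n exprS expr1 mulrA.
rewrite -expr2 sqrrN expr1n mul1r.
by congr (_ ^+ _); apply: eq_card => l; rewrite !inE andbA.
Qed.

Lemma wedge_signU1 i j S : i \notin S ->
  wedge_sign j (i |: S) = (-1) ^+ (i < j)%N * wedge_sign j S.
Proof.
move=> iS; have := wedge_signD1 j (setU11 i S).
by rewrite setU1K // => ->; rewrite mulrA -expr2 sqrr_sign mul1r.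
Qed.

Lemma epsiE i u T :
  epsi i u T = if i \in T then wedge_sign i T *: u (T :\ i) else 0.
Proof.
rewrite ffunE; case: ifP => iT; last first.
  rewrite big1 // => S _; rewrite /wedge_coef; case: ifP; rewrite ?scale0r //.
  by case/andP => _ /eqP TE; rewrite TE setU11 in iT.
rewrite (bigD1 (T :\ i)) //= big1 ?addr0; last first.
  move=> S SE; rewrite /wedge_coef; case: ifP; rewrite ?scale0r //.
  by case/andP => iS /eqP TE; rewrite TE setU1K // eqxx in SE.
rewrite /wedge_coef setD11 setD1K // eqxx; congr (_ *: _).
by rewrite -/(wedge_sign i _) wedge_signD1 // ltnn mul1r.
Qed.

Lemma iotaiE i u S :
  iotai i u S = if i \in S then 0 else wedge_sign i S *: u (i |: S).
Proof.
rewrite ffunE; case: ifP => iS.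
  by rewrite big1 // => T _; rewrite /wedge_coef iS conjC0 scale0r.
rewrite (bigD1 (i |: S)) //= big1 ?addr0 => [|T /negPf TE].
  (* The sign is real, so the conjugation in the adjoint fixes it. *)
  by rewrite /wedge_coef iS eqxx rmorphXn rmorphN1.
by rewrite /wedge_coef TE andbF conjC0 scale0r.
Qed.

Lemma epsi_is_linear i : linear (@epsi R m i).
Proof.
move=> k u v; apply/ffunP => T; rewrite !ffunE /= scaler_sumr -big_split /=.
apply: eq_bigr => S _; rewrite !ffunE scalerDr !scalerA; congr (_ *: _ + _).
exact: mulrC.
Qed.

Lemma iotai_is_linear i : linear (@iotai R m i).
Proof.
move=> k u v; apply/ffunP => T; rewrite !ffunE /= scaler_sumr -big_split /=.
apply: eq_bigr => S _; rewrite !ffunE scalerDr !scalerA; congr (_ *: _ + _).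
exact: mulrC.
Qed.

HB.instance Definition _ i :=
  GRing.isLinear.Build R[i] (Pm R m) (Pm R m) *:%R (@epsi R m i)
    (epsi_is_linear i).
HB.instance Definition _ i :=
  GRing.isLinear.Build R[i] (Pm R m) (Pm R m) *:%R (@iotai R m i)
    (iotai_is_linear i).

(** Exactly one of $i<j$ and $j<i$ holds. This is the source of the minus sign in all three
    anticommutation relations. *)
Lemma ltn_sign i j : i != j ->
  (-1) ^+ (i < j)%N = - (-1) ^+ (j < i)%N :> R[i].
Proof.
by rewrite -val_eqE; case: ltngtP => //=; rewrite expr0 expr1 ?opprK.
Qed.

Lemma epsi_epsi i j u : epsi i (epsi j u) + epsi j (epsi i u) = 0.
Proof.
apply/ffunP => T; rewrite [LHS]ffunE [RHS]ffunE !epsiE !inE.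
have [->|ij] /= := eqVneq i j.
  by rewrite ?scaler0 !if_same addr0.
case: ifP => iT; case: ifP => jT; rewrite ?scaler0 ?addr0 //.
rewrite !scalerA !wedge_signD1 // (ltn_sign ij).
have -> : T :\ i :\ j = T :\ j :\ i by apply/setP=> l; rewrite !inE andbCA.
rewrite -scalerDl mulNr mulrN mulrCA [wedge_sign j T * _]mulrCA.
by rewrite [wedge_sign j T * _]mulrC addNr scale0r.
Qed.

Lemma iotai_iotai i j u : iotai i (iotai j u) + iotai j (iotai i u) = 0.
Proof.
apply/ffunP => T; rewrite [LHS]ffunE [RHS]ffunE !iotaiE !inE.
have [->|ij] /= := eqVneq i j.
  by rewrite ?scaler0 !if_same addr0.
case: ifP => iT; case: ifP => jT; rewrite ?scaler0 ?addr0 //.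
rewrite !scalerA !wedge_signU1 ?iT ?jT // (ltn_sign ij) setUCA.
rewrite -scalerDl mulNr mulrN mulrCA [wedge_sign j T * _]mulrCA.
by rewrite [wedge_sign j T * _]mulrC addNr scale0r.
Qed.

(** For $i=j$, each coordinate receives exactly one of the two terms, according to whether $i\in T$,
    and its sign occurs squared. For $i\ne j$, the two terms carry opposite signs. *)
Lemma epsi_iotai i j u :
  epsi i (iotai j u) + iotai j (epsi i u) = (i == j)%:R *: u.
Proof.
apply/ffunP => T; rewrite [LHS]ffunE [RHS]ffunE !(epsiE, iotaiE) !inE.
have [<-|ij] /= := eqVneq i j.
  rewrite scale1r; case: ifP => iT /=; rewrite !scalerA.
    by rewrite addr0 wedge_signD1 // ltnn mul1r -expr2 sqrr_sign scale1r setD1K.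
  rewrite add0r wedge_signU1 ?iT // ltnn mul1r -expr2 sqrr_sign scale1r.
  by rewrite setU1K ?iT.
rewrite scale0r.
case: ifP => iT; case: ifP => jT; rewrite ?scaler0 ?addr0 //.
rewrite !scalerA wedge_signD1 // wedge_signU1 ?jT // (ltn_sign ij).
have -> : (j |: T) :\ i = j |: T :\ i.
  apply/setP => l; rewrite !inE; case: (eqVneq l i) => [->|] //=.
  by rewrite (negPf ij).
rewrite -scalerDl mulNr mulrN mulrCA [wedge_sign j T * _]mulrCA.
by rewrite [wedge_sign j T * _]mulrC addNr scale0r.
Qed.
End Exterior.

(** * Anticommutators of sums of exterior operators with polynomial coefficients *)

Section ExteriorSums.
Variables (R : realType) (m : nat).
Local Notation P := {mpoly R[i][m + m]}.
Implicit Types (u v : Pm R m) (f g : {linear P -> P}).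
Implicit Types A B : 'I_m -> {linear P -> P}.

Lemma coefwise_is_linear f : linear (coefwise (m := m) f).
Proof. by move=> k u v; apply/ffunP => S; rewrite !ffunE linearP. Qed.

HB.instance Definition _ f :=
  GRing.isLinear.Build R[i] (Pm R m) (Pm R m) *:%R (coefwise (m := m) f)
    (coefwise_is_linear f).

(** The matrix entries of [epsi i] are scalars, which the linear map [f] respects. *)
Lemma coefwise_epsi f i u : coefwise f (epsi i u) = epsi i (coefwise f u).
Proof.
apply/ffunP => T; rewrite !ffunE linear_sum; apply: eq_bigr => S _.
by rewrite linearZ ffunE.
Qed.

Lemma coefwise_iotai f i u : coefwise f (iotai i u) = iotai i (coefwise f u).
Proof.
apply/ffunP => T; rewrite !ffunE linear_sum; apply: eq_bigr => S _.
by rewrite linearZ ffunE.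
Qed.

Definition epsi_sum A u : Pm R m := \sum_i epsi i (coefwise (A i) u).
Definition iotai_sum A u : Pm R m := \sum_i iotai i (coefwise (A i) u).

Lemma epsi_sum_comp A B u :
  epsi_sum A (epsi_sum B u) =
  \sum_i \sum_j epsi i (epsi j (coefwise (A i) (coefwise (B j) u))).
Proof.
apply: eq_bigr => i _; rewrite !linear_sum; apply: eq_bigr => j _.
by rewrite /= coefwise_epsi.
Qed.

Lemma iotai_sum_comp A B u :
  iotai_sum A (iotai_sum B u) =
  \sum_i \sum_j iotai i (iotai j (coefwise (A i) (coefwise (B j) u))).
Proof.
apply: eq_bigr => i _; rewrite !linear_sum; apply: eq_bigr => j _.
by rewrite /= coefwise_iotai.
Qed.

Lemma epsi_iotai_sum A B u :
  epsi_sum A (iotai_sum B u) =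
  \sum_i \sum_j epsi i (iotai j (coefwise (A i) (coefwise (B j) u))).
Proof.
apply: eq_bigr => i _; rewrite !linear_sum; apply: eq_bigr => j _.
by rewrite /= coefwise_iotai.
Qed.

Lemma iotai_epsi_sum A B u :
  iotai_sum B (epsi_sum A u) =
  \sum_i \sum_j iotai j (epsi i (coefwise (B j) (coefwise (A i) u))).
Proof.
rewrite exchange_big; apply: eq_bigr => j _; rewrite !linear_sum.
by apply: eq_bigr => i _ /=; rewrite coefwise_epsi.
Qed.

Lemma coefwiseC f g u : f \o g =1 g \o f ->
  coefwise f (coefwise g u) = coefwise g (coefwise f u).
Proof. by move=> fg; apply/ffunP => S; rewrite !ffunE; apply: fg. Qed.

Lemma anticomm_epsi_sum A B u : (forall i j, A i \o B j =1 B j \o A i) ->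
  anticomm (epsi_sum A) (epsi_sum B) u = 0.
Proof.
(* Exchanging the indices of one double sum pairs $\varepsilon_i\varepsilon_j$ with
   $\varepsilon_j\varepsilon_i$ term by term. *)
move=> AB; rewrite /anticomm !epsi_sum_comp addrC exchange_big -big_split.
rewrite big1 // => i _; rewrite -big_split big1 // => j _ /=.
by rewrite (coefwiseC _ (AB i j)) epsi_epsi.
Qed.

Lemma anticomm_iotai_sum A B u : (forall i j, A i \o B j =1 B j \o A i) ->
  anticomm (iotai_sum A) (iotai_sum B) u = 0.
Proof.
move=> AB; rewrite /anticomm !iotai_sum_comp addrC exchange_big -big_split.
rewrite big1 // => i _; rewrite -big_split big1 // => j _ /=.
by rewrite (coefwiseC _ (AB i j)) iotai_iotai.
Qed.

(** The anticommutator of an operator with itself is twice its square, and $2$ is invertible in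
    characteristic zero. *)
Lemma epsi_sum_sqr A u : (forall i j, A i \o A j =1 A j \o A i) ->
  epsi_sum A (epsi_sum A u) = 0.
Proof.
move=> AA; have /eqP := anticomm_epsi_sum u AA.
rewrite /anticomm -mulr2n -scaler_nat scaler_eq0 pnatr_eq0 /=.
by move/eqP.
Qed.

Lemma iotai_sum_sqr A u : (forall i j, A i \o A j =1 A j \o A i) ->
  iotai_sum A (iotai_sum A u) = 0.
Proof.
move=> AA; have /eqP := anticomm_iotai_sum u AA.
rewrite /anticomm -mulr2n -scaler_nat scaler_eq0 pnatr_eq0 /=.
by move/eqP.
Qed.

(** The $(i,j)$ term equals $\{\varepsilon_i,\iota_j\}B_jA_i+k\delta_{ij}\varepsilon_i\iota_j$, so
    only the diagonal survives, and the commutator contributes $k\mathsf N$. *)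
Lemma anticomm_epsi_iotai_sum (k : R[i]) A B u :
  (forall i j p, A i (B j p) = B j (A i p) + (k * (i == j)%:R) *: p) ->
  anticomm (epsi_sum A) (iotai_sum B) u =
  \sum_i coefwise (B i) (coefwise (A i) u) + k *: opN u.
Proof.
move=> AB; rewrite /anticomm epsi_iotai_sum iotai_epsi_sum -big_split.
rewrite scaler_sumr -big_split; apply: eq_bigr => i _ /=.
have ABu j : coefwise (A i) (coefwise (B j) u) =
    coefwise (B j) (coefwise (A i) u) + (k * (i == j)%:R) *: u.
  by apply/ffunP => S; rewrite !ffunE.
rewrite -big_split (bigD1 i) //= big1 ?addr0 => [|j /negPf ji].
  rewrite ABu eqxx mulr1 !(linearD, linearZ) /= addrAC epsi_iotai eqxx scale1r.
  by [].
by rewrite ABu eq_sym ji mulr0 scale0r addr0 epsi_iotai eq_sym ji scale0r.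
Qed.
End ExteriorSums.

(** * The eigenvalues of $G_q$ and the conjugated Weyl relations *)

Section Weights.
Variables (R : realType) (m : nat) (q : R).
Hypothesis hq : 0 < q < 1.
Local Notation P := {mpoly R[i][m + m]}.

Definition Gq_weight (a : 'X_{1..m + m}) : R[i] := Gq_eigen q (zexp a) (wexp a).

Lemma prod_mnmD1 (F : comRingType) n (f : nat -> F) (r : F) (a : 'X_{1..n}) k :
  f (a k).+1 = f (a k) * r ->
  \prod_j f ((a + U_(k))%MM j) = (\prod_j f (a j)) * r.
Proof.
move=> fr; rewrite (bigD1 k) // [in RHS](bigD1 k) //= mnmDE mnm1E eqxx addn1 fr.
rewrite mulrAC; congr (_ * _ * _); apply: eq_bigr => j /negPf jk.
by rewrite mnmDE mnm1E eq_sym jk addn0.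
Qed.

(** Merging the $z$ and $w$ exponents into one product over all $2m$ variables lets both kinds of
    variable be treated at once. *)
Lemma Gq_weightE a :
  Gq_weight a = (\prod_k ((a k)`!)%:R) /
    (\prod_k \prod_(1 <= l < (a k).+1) qint q%:C%C l).
Proof.
rewrite /Gq_weight /Gq_eigen !big_split_ord /mfact /qmfact !natr_prod.
by congr (_ * _ / (_ * _)); apply: eq_bigr => i _; rewrite mnmE.
Qed.

Lemma Gq_weight_neq0 a : Gq_weight a != 0.
Proof. exact: Gq_eigen_neq0. Qed.

Lemma qC_neq1 : q%:C%C != 1.
Proof.
case/andP: hq => _ q1.
by rewrite -(rmorph1 (real_complex R)) (inj_eq (@fmorph_inj _ _ _)) lt_eqF.
Qed.

Lemma qint_neq0 n : qint q%:C%C n.+1 != 0.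
Proof.
case/andP: hq => q0 q1; rewrite /qint mulf_neq0 ?invr_eq0 // subr_eq0 eq_sym.
  rewrite -rmorphXn -(rmorph1 (real_complex R)) (inj_eq (@fmorph_inj _ _ _)).
  by rewrite lt_eqF // exprn_ilt1 // ltW.
exact: qC_neq1.
Qed.

(** Raising $a_k$ by one multiplies the weight by $(a_k+1)/[a_k+1]_q$: the recurrence required by
    [qderiv_conj]. *)
Lemma Gq_weightS a k :
  Gq_weight (a + U_(k))%MM * qint q%:C%C (a k).+1 = Gq_weight a * (a k).+1%:R.
Proof.
rewrite !Gq_weightE (@prod_mnmD1 _ _ (fun n => n`!%:R) (a k).+1%:R); last first.
  by rewrite factS mulnC natrM.
rewrite (@prod_mnmD1 _ _ (fun n => \prod_(1 <= l < n.+1) qint q%:C%C l)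
  (qint q%:C%C (a k).+1)); last by rewrite big_nat_recr.
by rewrite invfM mulrA mulfVK ?qint_neq0 // mulrAC.
Qed.

(** Multiplication is written ['X_k \*o idfun] so that the composite is recognized as a linear
    map. *)
Definition mulX_hat k : {linear P -> P} :=
  diag_mpoly Gq_weight \o ('X_k \*o idfun) \o
  diag_mpoly (fun a => (Gq_weight a)^-1).
Definition mderiv_hat k : {linear P -> P} :=
  diag_mpoly Gq_weight \o mderiv k \o diag_mpoly (fun a => (Gq_weight a)^-1).

Let GK := diag_mpolyK Gq_weight_neq0.
Let GVK := diag_mpolyVK Gq_weight_neq0.

Lemma mulX_hatC k l : mulX_hat k \o mulX_hat l =1 mulX_hat l \o mulX_hat k.
Proof. by move=> p; rewrite /= !GVK mulrCA. Qed.

Lemma mderiv_mulX_hat k l p :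
  mderiv_hat k (mulX_hat l p) = mulX_hat l (mderiv_hat k p) + (k == l)%:R *: p.
Proof. by rewrite /= !GVK mderiv_mulX linearD linearZ /= GK addrC. Qed.

Lemma mderiv_mulX_hatC k l : k != l ->
  mderiv_hat k \o mulX_hat l =1 mulX_hat l \o mderiv_hat k.
Proof.
move=> /negPf kl p; apply: etrans (mderiv_mulX_hat k l p) _.
by rewrite kl scale0r addr0.
Qed.

(** The inner factors $G_q^{-1}G_q$ cancel, leaving a conjugate of the Euler operator, which is
    diagonal and so commutes with $G_q$. *)
Lemma mulX_mderiv_hat k p : mulX_hat k (mderiv_hat k p) = 'X_k * mderiv k p.
Proof. by rewrite /= GVK !mulX_mderiv diag_mpolyC GK. Qed.

Lemma qderiv_hat k : qderiv q%:C%C k =1 mderiv_hat k.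
Proof.
by apply: qderiv_conj qC_neq1 Gq_weight_neq0 _ => a; apply: Gq_weightS.
Qed.

Lemma eq_coefwise (f g : P -> P) : f =1 g -> coefwise f =1 @coefwise R m g.
Proof. by move=> fg u; apply/ffunP => S; rewrite !ffunE fg. Qed.

Lemma zhatE i : @zhat R m q i =1 coefwise (mulX_hat (zidx i)).
Proof. by move=> u; apply/ffunP => S; rewrite !ffunE. Qed.

Lemma whatE i : @what R m q i =1 coefwise (mulX_hat (widx i)).
Proof. by move=> u; apply/ffunP => S; rewrite !ffunE. Qed.

Lemma DqE : @Dq R m q =1 epsi_sum (fun i => mderiv_hat (zidx i)).
Proof.
by move=> u; apply: eq_bigr => i _; rewrite -(eq_coefwise (qderiv_hat _)).
Qed.

Lemma Dq_dagE : @Dq_dag R m q =1 iotai_sum (fun i => mderiv_hat (widx i)).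
Proof.
by move=> u; apply: eq_bigr => i _; rewrite -(eq_coefwise (qderiv_hat _)).
Qed.

Lemma ZhatE : @Zhat R m q =1 iotai_sum (fun i => mulX_hat (zidx i)).
Proof. by move=> u; apply: eq_bigr => i _; rewrite zhatE. Qed.

Lemma Zhat_dagE : @Zhat_dag R m q =1 epsi_sum (fun i => mulX_hat (widx i)).
Proof. by move=> u; apply: eq_bigr => i _; rewrite whatE. Qed.

Lemma eq_anticomm (A A' B B' : Pm R m -> Pm R m) :
  A =1 A' -> B =1 B' -> anticomm A B =1 anticomm A' B'.
Proof. by move=> eA eB u; rewrite /anticomm !eA !eB. Qed.

Lemma zidx_neq_widx (i j : 'I_m) : (zidx i == widx j) = false.
Proof. exact: eq_lrshift. Qed.

Lemma widx_neq_zidx (i j : 'I_m) : (widx i == zidx j) = false.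
Proof. exact: eq_rlshift. Qed.

Lemma LapqE u : @Lapq R m q u = Gconj q (@Lap R m) u.
Proof.
rewrite /Gconj /Gq /Lap linear_sum /=.
apply: eq_bigr => i _; apply/ffunP => S; rewrite !ffunE.
by rewrite !qderiv_hat /= GVK.
Qed.
End Weights.

(** * The identities, by choice of coefficient operators *)

Theorem theorem5p3 (R : realType) (m : nat) (q : R)
    (hm : (1 <= m)%N) (hq : 0 < q < 1) :
  (forall u : Pm R m, Zhat q (Zhat q u) = 0) /\
  (forall u : Pm R m, Zhat_dag q (Zhat_dag q u) = 0) /\
  (forall u : Pm R m, anticomm (Zhat q) (Zhat_dag q) u = rhohat q u) /\
  (forall u : Pm R m, anticomm (Dq q) (Zhat_dag q) u = 0) /\
  (forall u : Pm R m, anticomm (Dq_dag q) (Zhat q) u = 0) /\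
  (forall u : Pm R m, anticomm (Dq q) (Zhat q) u = Ez u + opN u) /\
  (forall u : Pm R m,
     anticomm (Dq_dag q) (Zhat_dag q) u = Ew u + m%:R *: u - opN u) /\
  (forall u : Pm R m, Lapq q u = Gconj q (@Lap R m) u).
Proof.
have anticommC A B (u : Pm R m) : anticomm A B u = anticomm B A u.
  exact: addrC.
have mulXC (a b : 'I_m -> 'I_(m + m)) i j :
    mulX_hat q (a i) \o mulX_hat q (b j) =1
    mulX_hat q (b j) \o mulX_hat q (a i).
  exact: mulX_hatC hq _ _.
split=> [u|]; first by rewrite !ZhatE; apply: iotai_sum_sqr; apply: mulXC.
split=> [u|]; first by rewrite !Zhat_dagE; apply: epsi_sum_sqr; apply: mulXC.
split=> [u|].
  rewrite anticommC (eq_anticomm (@Zhat_dagE _ _ _) (@ZhatE _ _ _)).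
  (* Here $k=0$, since the $\widehat w_i$ and $\widehat z_j$ commute. *)
  rewrite (anticomm_epsi_iotai_sum (k := 0)) ?scale0r ?addr0; last first.
    by move=> i j p; rewrite mul0r scale0r addr0; apply: mulXC.
  by apply: eq_bigr => i _; rewrite zhatE whatE.
split=> [u|].
  rewrite (eq_anticomm (DqE hq) (@Zhat_dagE _ _ _)).
  apply: anticomm_epsi_sum => i j.
  exact (mderiv_mulX_hatC hq (negbT (zidx_neq_widx i j))).
split=> [u|].
  rewrite (eq_anticomm (Dq_dagE hq) (@ZhatE _ _ _)).
  apply: anticomm_iotai_sum => i j.
  exact (mderiv_mulX_hatC hq (negbT (widx_neq_zidx i j))).
split=> [u|].
  rewrite (eq_anticomm (DqE hq) (@ZhatE _ _ _)).
  (* Here $k=1$, from $[D_{q,z_i},\widehat z_j]=\delta_{ij}$. *)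
  rewrite (anticomm_epsi_iotai_sum (k := 1)) ?scale1r; last first.
    move=> i j p; rewrite mderiv_mulX_hat // mul1r.
    by rewrite (inj_eq (@lshift_inj _ _)).
  congr (_ + _); apply: eq_bigr => i _; apply/ffunP => S.
  by rewrite !ffunE mulX_mderiv_hat.
split=> [u|]; last by move=> u; apply: LapqE.
rewrite anticommC (eq_anticomm (@Zhat_dagE _ _ _) (Dq_dagE hq)).
(* The factor paired with $\varepsilon_i$ is now $\widehat w_i$, so the commutator is reversed and
   $k=-1$. *)
rewrite (anticomm_epsi_iotai_sum (k := -1)) ?scaleN1r; last first.
  move=> i j p; rewrite mderiv_mulX_hat // mulN1r scaleNr.
  by rewrite (inj_eq (@rshift_inj _ _)) eq_sym addrK.
(* Each $D_{q,w_i}\widehat w_i=\widehat w_iD_{q,w_i}+1$ yields one copy of [u]; the $m$ copies give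
   the term $m$. *)
congr (_ - _); rewrite -[m in m%:R *: _]card_ord scaler_nat.
rewrite -sumr_const -big_split.
apply: eq_bigr => i _; apply/ffunP => S; rewrite !ffunE.
by rewrite mderiv_mulX_hat // eqxx scale1r mulX_mderiv_hat.
Qed.
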